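(* For every integer $n\ge2$, $P_n(z)$ has no roots in $\Gamma_n$.
   Context: For $0\le k\le n$ let $\mathcal{B}(n,k)=\binom{n}{\lfloor (n-k)/2\rfloor}$ and $P_n(z)=\sum_{k=0}^n\mathcal{B}(n,k)z^{n-k}$. For $n\ge2$ let $K_n=\frac{n^2-1}{2n^2}$ and $$\Gamma_n=\left\{z\in\mathbb{C}:\ \frac{|z|}{\sqrt[n]{|1+z|}\,|1+z^2|}\le K_n,\ |z|\le1\right\}.$$ *)

(* Defs.v *)
From mathcomp Require Import all_boot all_order all_algebra.
From mathcomp Require Import classical_sets reals complex.

Set Implicit Arguments.
Unset Strict Implicit.
Unset Printing Implicit Defensive.

Import Order.TTheory GRing.Theory Num.Theory.
Local Open Scope ring_scope.
Local Open Scope complex_scope.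

Definition B (n k : nat) : nat := 'C(n, (n - k)./2).

Definition P (R : realType) (n : nat) : {poly R[i]} :=
  \sum_(k < n.+1) (B n k)%:R *: 'X^(n - k).

Definition K (R : realType) (n : nat) : R[i] :=
  (n%:R ^+ 2 - 1) / (2 * n%:R ^+ 2).

(* A point where the quotient is undefined (z = -1, z = i, z = -i) does not
   belong to Gamma n. This has to be said explicitly because x / 0 = 0 here:
   otherwise -1, which is a root of P 3, would belong to Gamma 3.
   Moduli are values in R[i], where x <= y means that y - x is real and
   nonnegative; n.-root is the nonnegative n-th root on nonnegative reals. *)
Definition Gamma (R : realType) (n : nat) : set R[i] :=
  [set z | [/\ 1 + z != 0,
               1 + z ^+ 2 != 0,
               `|z| / (n.-root `|1 + z| * `|1 + z ^+ 2|) <= K R n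
             & `|z| <= 1]]%classic.

Arguments Gamma : clear implicits.

(* Main.v *)
Require Import Defs.
From mathcomp Require Import all_boot all_order all_algebra.
From mathcomp Require Import classical_sets reals complex.
From mathcomp Require Import zify ring.

(** The coefficients of [P n] are those of [(1 + z) (1 + z^2)^n], a palindromic
    polynomial of degree [2n + 1] with coefficient sum [2^(n+1)], truncated at
    degree [n]. For [|z| <= 1] the discarded half is therefore at most
    [2^n |z|^n], while on [Gamma n] we have
    [|z|^n <= K_n^n |1 + z| |1 + z^2|^n] with [2 K_n < 1]. Hence the discarded
    half is smaller than [(1 + z) (1 + z^2)^n] and the two cannot be equal. *)

Local Open Scope ring_scope.
Local Open Scope complex_scope.

Import Order.TTheory GRing.Theory Num.Theory.

Lemma sum_ord_double (V : nmodType) (F : nat -> V) (m : nat) :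
  \sum_(i < m.*2) F i = \sum_(i < m) (F i.*2 + F i.*2.+1).
Proof.
elim: m => [|m IHm]; first by rewrite !big_ord0.
by rewrite doubleS !big_ord_recr /= IHm addrA.
Qed.

(** The factor [1 + z] copies the coefficient of [z^(2i)] in [(1 + z^2)^n] to degree [2i + 1], hence
    the index [j./2]. *)
Lemma mul_1Dx_exp_1Dx2E (R : comNzRingType) (n : nat) (z : R) :
  (1 + z) * (1 + z ^+ 2) ^+ n = \sum_(0 <= j < n.+1.*2) 'C(n, j./2)%:R * z ^+ j.
Proof.
rewrite big_mkord (sum_ord_double _ (fun j => 'C(n, j./2)%:R * z ^+ j)).
rewrite exprDn mulr_sumr; apply: eq_bigr => i _ /=.
rewrite doubleK uphalf_double expr1n -exprM mul2n exprS -mulr_natl.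
by rewrite mul1r; ring.
Qed.

Lemma sum_upper_half_bin (n : nat) :
  (\sum_(n.+1 <= j < n.+1.*2) 'C(n, j./2) = 2 ^ n)%N.
Proof.
have total : (\sum_(0 <= j < n.+1.*2) 'C(n, j./2) = 2 ^ n.+1)%N.
  (* Evaluation at 1 is done in [int], where the cast from [nat] is injective. *)
  have /eqP := mul_1Dx_exp_1Dx2E int n 1.
  rewrite (eq_bigr (fun j => 'C(n, j./2)%:R)) => [|j _]; last by rewrite expr1n mulr1.
  by rewrite expr1n -natr_sum -exprS -mulr2n -natrX eqr_nat => /eqP.
have palindromic :
    (\sum_(0 <= j < n.+1) 'C(n, j./2) = \sum_(n.+1 <= j < n.+1.*2) 'C(n, j./2))%N.
  rewrite big_nat_rev /= -[in RHS](add0n n.+1) big_addn !add0n.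
  rewrite -addnn addnK !big_mkord; apply: eq_bigr => i _.
  have lt_in := ltn_ord i.
  (* Binomial symmetry suffices, as [n - (n - i)./2 = (i + n.+1)./2]. *)
  rewrite -bin_sub; last by lia.
  congr 'C(n, _); lia.
move: total; rewrite (@big_cat_nat _ _ _ n.+1) //=; last by lia.
by rewrite palindromic addnn -mul2n expnS => /eqP; rewrite eqn_pmul2l // => /eqP.
Qed.

Lemma horner_P (R : realType) (n : nat) (z : R[i]) :
  (P R n).[z] = \sum_(0 <= j < n.+1) 'C(n, j./2)%:R * z ^+ j.
Proof.
rewrite /P horner_sum big_nat_rev /= big_mkord; apply: eq_bigr => k _.
by rewrite hornerZ hornerXn /B add0n subSS.
Qed.

(** All exponents exceed [n]; the power [n] is kept to match the n-th power of the inequality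
    defining [Gamma]. *)
Lemma norm_upper_half_le (R : numDomainType) (n : nat) (z : R) :
  `|z| <= 1 ->
  `|\sum_(n.+1 <= j < n.+1.*2) 'C(n, j./2)%:R * z ^+ j| <= 2 ^+ n * `|z| ^+ n.
Proof.
move=> z_le1; rewrite -natrX -sum_upper_half_bin natr_sum mulr_suml.
apply: le_trans (ler_norm_sum _ _ _) _; rewrite !big_nat; apply: ler_sum => j /andP[lt_nj _].
rewrite normrM normr_nat normrX ler_wpM2l ?ler0n //.
by rewrite ler_wiXn2l // ltnW.
Qed.

Lemma Gamma_norm_exp_le (R : realType) (n : nat) (z : R[i]) :
  (0 < n)%N -> Gamma R n z ->
  `|z| ^+ n <= K R n ^+ n * (`|1 + z| * `|1 + z ^+ 2| ^+ n).
Proof.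
move=> n_gt0 [z1_neq0 z2_neq0 leK _].
have den_gt0 : 0 < n.-root `|1 + z| * `|1 + z ^+ 2|.
  by rewrite mulr_gt0 ?rootC_gt0 ?normr_gt0.
move: leK; rewrite ler_pdivrMr // => leK.
(* Taking n-th powers removes the root; the right side is nonnegative because it bounds [|z|]. *)
have := lerXn2r n (normr_ge0 z) (le_trans (normr_ge0 z) leK) leK.
by rewrite !exprMn rootCK.
Qed.

(** Here [2 K_n = 1 - 1/n^2] lies in [[0, 1)]. *)
Lemma exp_2K_lt1 (R : realType) (n : nat) :
  (0 < n)%N -> 2 ^+ n * K R n ^+ n < 1.
Proof.
move=> n_gt0; rewrite -exprMn.
have n2_gt0 : (0 : R[i]) < n%:R ^+ 2 by rewrite exprn_gt0 // ltr0n.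
have -> : 2 * K R n = (n%:R ^+ 2 - 1) / n%:R ^+ 2.
  by rewrite /K; field; rewrite pnatr_eq0 -lt0n.
rewrite exprn_ilt1 -?lt0n //.
  by rewrite divr_ge0 ?(ltW n2_gt0) // subr_ge0 exprn_ege1 // ler1n.
by rewrite ltr_pdivrMr // mul1r ltrBlDr ltrDl ltr01.
Qed.

Theorem theorem5p2 (R : realType) (n : nat) (hn : (2 <= n)%N) (z : R[i]) :
  Gamma R n z -> ~~ root (P R n) z.
Proof.
move=> Gz; have n_gt0 := ltnW hn.
have [z1_neq0 z2_neq0 _ z_le1] := Gz.
apply/negP => /rootP; rewrite horner_P => Pz0.
set w := (1 + z) * (1 + z ^+ 2) ^+ n.
(* The final strict inequality scales [|w|] by a factor below 1, so [w] must not vanish; this is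
   where [z] differing from -1, i and -i enters. *)
have w_gt0 : 0 < `|w| by rewrite normr_gt0 mulf_neq0 ?expf_neq0.
have w_tail : w = \sum_(n.+1 <= j < n.+1.*2) 'C(n, j./2)%:R * z ^+ j.
  rewrite /w mul_1Dx_exp_1Dx2E (@big_cat_nat _ _ _ n.+1) /= ?Pz0 ?add0r //; lia.
suff : `|w| < `|w| by rewrite ltxx.
rewrite {1}w_tail; apply: le_lt_trans (norm_upper_half_le _ n _ z_le1) _.
apply: (@le_lt_trans _ _ (2 ^+ n * K R n ^+ n * `|w|)).
  rewrite -mulrA ler_wpM2l ?exprn_ge0 // normrM normrX.
  exact: Gamma_norm_exp_le.
by rewrite gtr_pMl // exp_2K_lt1.
Qed.
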